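(* Let $A\in\mathbb{R}^{n\times n}$ have all eigenvalues with negative real part, let $B\in\mathbb{R}^{n\times1}$ (scalar input, $m=1$) with $(A,B)$ controllable, and let $C_1\in\mathbb{R}^{p_1\times n}$, $C_2\in\mathbb{R}^{p_2\times n}$ with $p_1\ge p_2$. Consider $$\dot x(t)=Ax(t)+Bu(t),\quad x(0)=0,\quad y_i(t)=C_ix(t),\qquad i\in\{1,2\}$$ (i.e. $D_1=0$, $D_2=0$), with $u\in\mathcal{L}_{2e}$. For $i\in\{1,2\}$, $j\in\{1,\dots,p_i\}$ let $r_{ij}$ be the relative degree of the system from the input $u$ to the $j$-th component $y_{ij}$ of $y_i$, and let $r_2^{\min}=\min_{j\in\{1,\dots,p_2\}}r_{2j}$. Consider the modified closed-loop dynamics $$\dot{\bar x}(t)=\bar A\bar x(t)+\bar Bu(t),\qquad \bar y_1(t)=\bar C_1\bar x(t),\qquad \bar y_2(t)=\bar C_2\bar x(t),$$ where $\bar y_2(t)=y_2(t)$ and, for all $j\in\{1,\dots,p_1\}$, $$\bar y_{1j}(t)=\begin{cases}y_{1j}(t)&\text{if } r_{1j}\ge r_2^{\min},\\[4pt] \underbrace{\int_0^t\cdots\int_0^{\tau_1}}_{\tilde r_{1j}\text{ times}}y_{1j}(\tau_0)\,d\tau_0\cdots d\tau_{\tilde r_{1j}-1}&\text{otherwise,}\end{cases}\qquad \tilde r_{1j}=r_2^{\min}-r_{1j}.$$ Let $\bar r_{ij}$, $i\in\{1,2\}$, $j\in\{1,\dots,p_i\}$, denote the relative degree of the modified system from the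 input $u$ to the output $\bar y_{ij}$, and let $\bar r_i^{\min}=\min_{j\in\{1,\dots,p_i\}}\bar r_{ij}$ for $i\in\{1,2\}$. Then $$\bar r_1^{\min}\ge\bar r_2^{\min}.$$
   Context: Relative degree: for a strictly proper single-input single-output system with realization $(A,B,C,0)$, the relative degree is $r=\min\{k\in\mathbb{Z}_+ : CA^{k-1}B\neq0\}$, with $k\ge1$ (the notation presupposes that this set is nonempty). For $y_{ij}$ the output matrix $C$ is the $j$-th row of $C_i$, and analogously for $\bar y_{ij}$ with $(\bar A,\bar B,\bar C_i)$. The modified system $(\bar A,\bar B,\bar C_1,\bar C_2)$ is a linear time-invariant realization with zero initial state whose outputs, for every input $u$, are the signals $\bar y_1,\bar y_2$ described in the claim; the displayed iterated integral is the $\tilde r_{1j}$-fold application of $y\mapsto\int_0^{\,\cdot}y(\tau)\,d\tau$. $\mathcal{L}_{2e}$ is the set of signals $u:\mathbb{R}_+\to\mathbb{R}^m$ with $\int_0^{T}u(t)^\top u(t)\,dt<\infty$ for every $T\in\mathbb{R}_+$. *)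

(* Defs.v *)
From HB Require Import structures.
From mathcomp Require Import all_boot all_order all_algebra.
From mathcomp Require Import all_classical all_reals all_analysis.
From mathcomp Require Import complex.

Set Implicit Arguments.
Unset Strict Implicit.
Unset Printing Implicit Defensive.

Import Order.TTheory GRing.Theory Num.Theory.
Import numFieldNormedType.Exports.

Local Open Scope classical_set_scope.
Local Open Scope ring_scope.

(* Signals on R_+ are total functions on R; only their values on [0, +oo[
   are ever used. *)

Definition L2e (R : realType) (m : nat) (u : R -> 'cV[R]_m) : Prop :=
  (forall i, measurable_fun (`[0, +oo[ : set R) (fun t : R => u t i 0)) /\
  (forall T : R, 0 <= T ->
    (\int[lebesgue_measure]_(t in `[0%R, T])
       (((u t)^T *m u t) 0 0)%:E < +oo)%E).

(* x solves x' = A x + B u, x(0) = x0 in the sense of Caratheodory: an input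
   in L2e is only defined almost everywhere, so the equation is read in its
   integral form, coordinate by coordinate. *)
Definition state_trajectory (R : realType) (n m : nat)
    (A : 'M[R]_n) (B : 'M[R]_(n, m)) (x0 : 'cV[R]_n)
    (u : R -> 'cV[R]_m) (x : R -> 'cV[R]_n) : Prop :=
  forall (t : R) (i : 'I_n), 0 <= t ->
    let dx := fun s : R => (A *m x s + B *m u s) i 0 in
    lebesgue_measure.-integrable `[0, t] (EFin \o dx) /\
    x t i 0 = x0 i 0 + \int[lebesgue_measure]_(s in `[0, t]) dx s.

Definition controllable (R : realType) (n m : nat)
    (A : 'M[R]_n) (B : 'M[R]_(n, m)) : Prop :=
  forall x0 x1 : 'cV[R]_n,
    exists (T : R) (u : R -> 'cV[R]_m) (x : R -> 'cV[R]_n),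
      [/\ 0 < T, L2e u, state_trajectory A B x0 u x & x T = x1].

Definition Hurwitz (R : realType) (n : nat) (A : 'M[R]_n) : Prop :=
  forall l : R[i]%C,
    eigenvalue (map_mx (real_complex R) A) l -> complex.Re l < 0.

Definition is_least (S : set nat) (k : nat) : Prop :=
  S k /\ forall l, S l -> (k <= l)%N.

(* This presupposes that some C A^(k-1) B is nonzero. *)
Definition is_relative_degree (R : realType) (n : nat)
    (A : 'M[R]_n) (B : 'cV[R]_n) (C : 'rV[R]_n) (r : nat) : Prop :=
  is_least [set k | (1 <= k)%N /\ C *m (A ^+ (k - 1)) *m B <> 0] r.

Definition integral_from0 (R : realType) (y : R -> R) : R -> R :=
  fun t => \int[lebesgue_measure]_(s in `[0, t]) y s.

(* The output obtained from y, of relative degree r, when the smallest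
   relative degree of the second output is rmin. *)
Definition modified_output (R : realType) (rmin r : nat) (y : R -> R) : R -> R :=
  if (rmin <= r)%N then y else iter (rmin - r) (@integral_from0 R) y.

(* Main.v *)
(** Feed both systems the step input [u = 1].  From the zero state, every output
    is the exponential generating function of its Markov parameters:
    [C x(t) = \sum_(k >= 1) C A^(k-1) B t^k / k!], so a relative degree is the
    index of the first nonzero coefficient, and coefficients are determined by
    the values of the function on [t >= 0].  Integrating from [0] shifts the
    coefficients by one place, so every modified output [yb_1j] has only zero
    coefficients below [r2min], while [yb_2 = y_2] keeps the relative degrees
    [r_2j]; hence [rb1min >= r2min = rb2min]. *)

Require Import Defs.
From HB Require Import structures.
From mathcomp Require Import all_boot all_order all_algebra.
From mathcomp Require Import all_classical all_reals all_analysis.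

Set Implicit Arguments.
Unset Strict Implicit.
Unset Printing Implicit Defensive.

Import Order.TTheory GRing.Theory Num.Theory.
Import numFieldNormedType.Exports.

Local Open Scope classical_set_scope.
Local Open Scope ring_scope.

(** * Exponential generating functions of real sequences *)

Section ExponentialGeneratingFunction.
Variable R : realType.
Implicit Types (a b : R^nat) (t : R).

(** This growth makes the series of [egf a] converge at every real. Asking [1 <= M] lets the same
    [K] and [M] serve after a right shift. *)
Definition geometrically_bounded a :=
  exists K M : R, 1 <= M /\ forall k, `|a k| <= K * M ^+ k.

Definition egf a t : R := limn (pseries (fun k => a k / k`!%:R) t).

(** Under [egf] this becomes differentiation, and [cons0_seq] becomes integration from 0. *)
Definition shift_seq a : R^nat := fun k => a k.+1.

Definition cons0_seq a : R^nat := fun k => if k is k'.+1 then a k' else 0.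

Lemma geometrically_bounded_shift a :
  geometrically_bounded a -> geometrically_bounded (shift_seq a).
Proof.
move=> [K [M [M1 aKM]]]; exists (K * M), M; split=> // k.
by rewrite -mulrA -exprS; exact: aKM.
Qed.

Lemma geometrically_bounded_cons0 a :
  geometrically_bounded a -> geometrically_bounded (cons0_seq a).
Proof.
move=> [K [M [M1 aKM]]].
have K0 : 0 <= K by have := aKM 0%N; rewrite mulr1; apply: le_trans.
exists K, M; split=> // -[|k] /=; first by rewrite normr0 mulr1.
rewrite (le_trans (aKM k))// ler_wpM2l// exprS ler_peMl//.
by rewrite exprn_ge0// (le_trans _ M1).
Qed.

Lemma geometrically_bounded_sum n (c : 'I_n -> R) (a : 'I_n -> R^nat) :
  (forall i, geometrically_bounded (a i)) ->
  geometrically_bounded (fun k => \sum_i c i * a i k).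
Proof.
move=> /choice[K] /choice[M] aKM.
(* The common base dominates each [M i], and is at least 1 even when [n = 0]. *)
exists (\sum_i `|c i| * K i), (1 + \sum_i M i).
have M0 i : 0 <= M i by rewrite (le_trans ler01)//; case: (aKM i).
split=> [|k]; first by rewrite lerDl sumr_ge0.
rewrite mulr_suml (le_trans (ler_norm_sum _ _ _))// ler_sum// => i _.
rewrite normrM -mulrA ler_wpM2l//.
case: (aKM i) => _ aKMi; rewrite (le_trans (aKMi k))//.
have K0 : 0 <= K i by have := aKMi 0%N; rewrite mulr1; apply: le_trans.
rewrite ler_wpM2l// lerXn2r// ?nnegrE ?addr_ge0 ?sumr_ge0//.
by rewrite (bigD1 i)//= addrCA lerDl addr_ge0// sumr_ge0.
Qed.

(** The absolute values are dominated by [K] times the exponential series at [M * |t|]. *)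
Lemma is_cvg_egf a t : geometrically_bounded a ->
  cvgn (pseries (fun k => a k / k`!%:R) t).
Proof.
move=> [K [M [M1 aKM]]]; apply: normed_cvg.
have K0 : 0 <= K by have := aKM 0%N; rewrite mulr1; apply: le_trans.
have M0 : 0 <= M by rewrite (le_trans ler01).
have KM0 k : 0 <= K * exp_coeff (M * `|t|) k.
  by rewrite mulr_ge0// exp_coeff_ge0// mulr_ge0.
apply: (series_le_cvg _ KM0) => [k|k|]; first exact: normr_ge0.
  rewrite /exp_coeff /= !normrM normfV normrX [`|k`!%:R|]ger0_norm//.
  rewrite exprMn [in leRHS]mulrAC !mulrA.
  by rewrite !ler_wpM2r// ?invr_ge0// exprn_ge0.
exact: (is_cvg_seriesZ (is_cvg_series_exp_coeff _)).
Qed.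

(** The hypothesis covers two cases at once: [t = 0], and a sequence supported at index 0. *)
Lemma egf_first a t : (forall k, a k.+1 * t ^+ k.+1 = 0) -> egf a t = a 0%N.
Proof.
move=> a0; apply/cvg_lim => //; rewrite -cvg_shiftS.
rewrite [X in X @ _](_ : _ = fun=> a 0%N); first exact: cvg_cst.
apply/funext => k; rewrite /pseries /series /= big_nat_recl//= big1 => [|i _].
  by rewrite addr0 expr0 mulr1 divr1.
by rewrite mulrAC a0 mul0r.
Qed.

Lemma egfD a b t : geometrically_bounded a -> geometrically_bounded b ->
  egf (a + b) t = egf a t + egf b t.
Proof.
move=> /(@is_cvg_egf _ t) ca /(@is_cvg_egf _ t) cb.
rewrite /egf -(lim_seriesD ca cb); congr (limn (series _)).
by apply/funext => k; rewrite /= !fctE !mulrDl.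
Qed.

Lemma egf_sum n (c : 'I_n -> R) (a : 'I_n -> R^nat) t :
  (forall i, geometrically_bounded (a i)) ->
  egf (fun k => \sum_i c i * a i k) t = \sum_i c i * egf (a i) t.
Proof.
move=> ba; apply/cvg_lim => //.
rewrite [X in X @ _](_ : _ = fun k => \sum_i c i *
    pseries (fun k => a i k / k`!%:R) t k); last first.
  apply/funext => k; rewrite /pseries /series /=.
  under [RHS]eq_bigr do rewrite mulr_sumr.
  rewrite exchange_big/=; apply: eq_bigr => j _.
  by rewrite !mulr_suml; apply: eq_bigr => i _; rewrite !mulrA.
apply: cvg_big => [|i _]; first exact: add_continuous.
apply: cvgMl_tmp; exact: is_cvg_egf.
Qed.

Lemma is_derive_egf a t : geometrically_bounded a ->
  is_derive t (1 : R) (egf a) (egf (shift_seq a) t).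
Proof.
move=> ba.
have diffsE b : pseries_diffs (fun k => b k / k`!%:R) =
    (fun k => shift_seq b k / k`!%:R).
  apply/funext => k; rewrite /pseries_diffs factS natrM invfM mulrCA.
  by congr (_ * _); rewrite mulrA divff ?mul1r// pnatr_eq0.
have bb := geometrically_bounded_shift ba.
(* Termwise differentiation at [t] asks for convergence at some point of larger modulus; any would
   do. *)
rewrite /egf -diffsE; apply: (@pseries_snd_diffs _ _ (`|t| + 1)).
- exact: is_cvg_egf.
- by rewrite diffsE; exact: is_cvg_egf.
- by rewrite !diffsE; apply: is_cvg_egf; exact: geometrically_bounded_shift.
- by rewrite [ltRHS]ger0_norm ?ltrDl// addr_ge0.
Qed.

Lemma continuous_egf a : geometrically_bounded a -> continuous (egf a).
Proof.
move=> ba t; apply: differentiable_continuous.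
by apply/derivable1_diffP; case: (is_derive_egf t ba).
Qed.

Lemma integrable_egf a t : geometrically_bounded a ->
  lebesgue_measure.-integrable `[0, t] (EFin \o egf a).
Proof.
move=> ba; apply: continuous_compact_integrable; first exact: segment_compact.
exact/continuous_subspaceT/continuous_egf.
Qed.

Lemma Rintegral_egf_shift a t : geometrically_bounded a -> 0 <= t ->
  \int[lebesgue_measure]_(s in `[0, t]) egf (shift_seq a) s = egf a t - a 0%N.
Proof.
move=> ba; rewrite -[in RHS](@egf_first a 0) => [|k]; last first.
  by rewrite expr0n mulr0.
rewrite le_eqVlt => /predU1P[<-|t0].
  by rewrite set_itv1 Rintegral_set1 subrr.
have da s : derivable (egf a) s 1 by case: (is_derive_egf s ba).
rewrite /Rintegral (continuous_FTC2 t0 _ (F := egf a))//.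
- apply/continuous_subspaceT/continuous_egf.
  exact: geometrically_bounded_shift.
- split => //.
  + exact/cvg_at_right_filter/continuous_egf.
  + exact/cvg_at_left_filter/continuous_egf.
- by move=> s _; rewrite derive1E; case: (is_derive_egf s ba).
Qed.

(** By continuity [a 0] is the right limit of [egf a] at 0. Positive reals form an open set, so the
    derivative [egf (shift_seq a)] vanishes there too, and induction reaches every coefficient. *)
Lemma egf_eq0 a : geometrically_bounded a ->
  (forall t, 0 < t -> egf a t = 0) -> a = 0.
Proof.
move=> ba a0; apply/funext => k.
elim: k a ba a0 => [|k IHk] a ba a0.
  rewrite -(@egf_first a 0) => [|k]; last by rewrite expr0n mulr0.
  have ra : egf a s @[s --> 0^'+] --> egf a 0.
    exact/cvg_at_right_filter/continuous_egf.
  apply: (cvg_unique _ ra) => //.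
  apply: cvg_near_cst; near=> s; apply: a0; near: s; exact: nbhs_right_gt.
apply: (IHk (shift_seq a)) => [|t t0]; first exact: geometrically_bounded_shift.
case: (is_derive_egf t ba) => _ <-.
rewrite (near_eq_derive _ (g := cst 0)) ?derive_cst ?oner_eq0//.
by near=> s; apply: a0; near: s; exact: lt_nbhsr.
Unshelve. all: by end_near. Qed.

Lemma egf_inj a b : geometrically_bounded a -> geometrically_bounded b ->
  (forall t, 0 <= t -> egf a t = egf b t) -> a = b.
Proof.
move=> ba bb ab; have bab : geometrically_bounded (a - b).
  (* The difference is a two-term combination, so [geometrically_bounded_sum] applies. *)
  pose c (i : 'I_2) : R := if i == 0 then 1 else -1.
  pose f (i : 'I_2) : R^nat := if i == 0 then a else b.
  have -> : a - b = fun k => \sum_i c i * f i k.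
    apply/funext => k; rewrite !big_ord_recl big_ord0 /c /f /=.
    by rewrite mul1r mulN1r addr0.
  by apply: geometrically_bounded_sum => i; rewrite /f; case: ifP.
apply/eqP; rewrite -subr_eq0; apply/eqP; apply: egf_eq0 => // t t0.
by apply: (addIr (egf b t)); rewrite -egfD// subrK add0r ab// ltW.
Qed.

Lemma integral_from0_egf a (f : R -> R) :
  geometrically_bounded a -> (forall t, 0 <= t -> f t = egf a t) ->
  forall t, 0 <= t -> integral_from0 f t = egf (cons0_seq a) t.
Proof.
move=> ba fa t t0; rewrite /integral_from0.
have := Rintegral_egf_shift (geometrically_bounded_cons0 ba) t0.
rewrite subr0 => <-; apply: eq_Rintegral => s.
by rewrite inE /= in_itv /= => /andP[s0 _]; rewrite fa.
Qed.

Lemma iter_integral_from0_egf m a (f : R -> R) :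
  geometrically_bounded a -> (forall t, 0 <= t -> f t = egf a t) ->
  geometrically_bounded (iter m cons0_seq a) /\
  forall t, 0 <= t ->
    iter m (@integral_from0 R) f t = egf (iter m cons0_seq a) t.
Proof.
move=> ba fa; elim: m => //= m [bm fm]; split.
  exact: geometrically_bounded_cons0.
exact: integral_from0_egf.
Qed.

Lemma iter_cons0_seq_eq0 m r a : (forall k, (k < r)%N -> a k = 0) ->
  forall k, (k < m + r)%N -> iter m cons0_seq a k = 0.
Proof. by move=> a0; elim: m => // m IHm [|k] //=; exact: IHm. Qed.

End ExponentialGeneratingFunction.

(** * The unit step response of a linear system *)

Section StepResponse.
Variables (R : realType) (n : nat) (A : 'M[R]_n) (B : 'cV[R]_n).

(** The derivatives at time 0 of the state under the unit step: the index runs one ahead of the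
    power of [A], and the value at index 0 is the zero initial state. *)
Definition step_coef (k : nat) : 'cV[R]_n :=
  if k is k'.+1 then A ^+ k' *m B else 0.

Definition step_state (t : R) : 'cV[R]_n :=
  \col_i egf (fun k => step_coef k i 0) t.

Lemma geometrically_bounded_step_coef i :
  geometrically_bounded (fun k => step_coef k i 0).
Proof.
have -> : (fun k => step_coef k i 0) =
    cons0_seq (fun k => (A ^+ k *m B) i 0).
  by apply/funext => -[|k] //=; rewrite mxE.
apply: geometrically_bounded_cons0.
(* In the l1 norm, multiplication by [A] enlarges a vector by a factor at most [N], and [K] is the
   norm of [B]. *)
pose N := \sum_i \sum_j `|A i j|; pose K := \sum_i `|B i 0|.
have N0 : 0 <= N by rewrite sumr_ge0// => ? _; rewrite sumr_ge0.
exists K, (1 + N); split=> [|k]; first by rewrite lerDl.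
suff : \sum_i `|(A ^+ k *m B) i 0| <= K * (1 + N) ^+ k.
  by apply: le_trans; rewrite (bigD1 i)//= lerDl sumr_ge0.
elim: k => [|k IHk]; first by rewrite mulr1 expr0 -[1]/(1%:M) mul1mx.
rewrite [_ ^+ k.+1 in leRHS]exprSr mulrA.
apply: le_trans (_ : (\sum_i `|(A ^+ k *m B) i 0|) * N <= _); last first.
  by rewrite ler_pM// ?sumr_ge0// lerDr.
rewrite mulrC mulr_suml ler_sum// => l _.
rewrite exprS -mulmxE -mulmxA mxE (le_trans (ler_norm_sum _ _ _))//.
rewrite mulr_suml ler_sum// => j _; rewrite normrM ler_wpM2l//.
by rewrite (bigD1 j)//= lerDl sumr_ge0.
Qed.

Lemma geometrically_bounded_mul_step_coef p (C : 'M[R]_(p, n)) i :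
  geometrically_bounded (fun k => (C *m step_coef k) i 0).
Proof.
under eq_fun do rewrite mxE.
exact/geometrically_bounded_sum/geometrically_bounded_step_coef.
Qed.

Lemma mul_step_stateE p (C : 'M[R]_(p, n)) i t :
  (C *m step_state t) i 0 = egf (fun k => (C *m step_coef k) i 0) t.
Proof.
under [in RHS]eq_fun do rewrite mxE.
rewrite egf_sum => [|j]; last exact: geometrically_bounded_step_coef.
by rewrite mxE; apply: eq_bigr => j _; rewrite mxE.
Qed.

Lemma state_trajectory_step_state :
  state_trajectory A B 0 (fun=> 1%:M) step_state.
Proof.
move=> t i t0 dx; set a : R^nat := fun k => step_coef k i 0.
have ba : geometrically_bounded a := geometrically_bounded_step_coef i.
have dxE : dx = egf (shift_seq a).
  apply/funext => s.
  (* The constant forcing term is itself an [egf], so [dx] reduces to the recursion on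
     [step_coef]. *)
  pose b : R^nat := fun k => if k is 0 then B i 0 else 0.
  have bb : geometrically_bounded b.
    exists `|B i 0|, 1; split=> // -[|k]; rewrite /= expr1n mulr1//.
    by rewrite normr0.
  rewrite /dx mulmx1 mxE mul_step_stateE.
  have <- : egf b s = B i 0 by apply: egf_first => k; rewrite mul0r.
  rewrite -egfD//; last exact: geometrically_bounded_mul_step_coef.
  congr (egf _ s); apply/funext => -[|k]; rewrite /a /shift_seq /= fctE.
    by rewrite mulmx0 mxE add0r expr0 -[1]/(1%:M) mul1mx.
  by rewrite addr0 exprS -mulmxE mulmxA.
rewrite dxE; split; first exact/integrable_egf/geometrically_bounded_shift.
by rewrite Rintegral_egf_shift// /a !mxE add0r subr0.
Qed.

(** The coefficient at index 0 vanishes, which accounts for the condition [1 <= k]. *)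
Lemma is_relative_degree_step_coef (C : 'rV[R]_n) r :
  is_relative_degree A B C r <->
  is_least [set k | (C *m step_coef k) 0 0 <> 0] r.
Proof.
rewrite /is_relative_degree.
suff -> : [set k | (1 <= k)%N /\ C *m A ^+ (k - 1) *m B <> 0] =
          [set k | (C *m step_coef k) 0 0 <> 0] by [].
apply/seteqP; split=> -[|k] /=.
- by case.
- rewrite subn1 /= mulmxA => -[_ CAB0] CAB; apply: CAB0.
  by apply/matrixP => i j; rewrite !ord1 CAB mxE.
- by rewrite mulmx0 mxE.
- rewrite subn1 /= mulmxA => CAB; split=> // CAB0.
  by apply: CAB; rewrite CAB0 mxE.
Qed.

End StepResponse.

(** * Comparison of the original and modified systems *)

Lemma L2e_cst (R : realType) (m : nat) (v : 'cV[R]_m) : L2e (fun=> v).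
Proof.
split=> [i|T T0]; first exact: measurable_cst.
rewrite integral_cst//= lebesgue_measure_itv/=.
by case: ifP => _; rewrite ?mule0 -?EFinB -?EFinM ltry.
Qed.

Lemma is_least_unique (S : set nat) k l :
  is_least S k -> is_least S l -> k = l.
Proof.
move=> [Sk lek] [Sl lel]; apply/eqP.
by rewrite eqn_leq lek// lel.
Qed.

Theorem theorem8 (R : realType) (n p1 p2 : nat)
    (A : 'M[R]_n) (B : 'cV[R]_n) (C1 : 'M[R]_(p1, n)) (C2 : 'M[R]_(p2, n))
    (r1 : 'I_p1 -> nat) (r2 : 'I_p2 -> nat) (r2min : nat)
    (nb : nat) (Ab : 'M[R]_nb) (Bb : 'cV[R]_nb)
    (Cb1 : 'M[R]_(p1, nb)) (Cb2 : 'M[R]_(p2, nb))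
    (rb1 : 'I_p1 -> nat) (rb2 : 'I_p2 -> nat) (rb1min rb2min : nat) :
  Hurwitz A ->
  controllable A B ->
  (p2 <= p1)%N ->
  (forall j, is_relative_degree A B (row j C1) (r1 j)) ->
  (forall j, is_relative_degree A B (row j C2) (r2 j)) ->
  is_least (range r2) r2min ->
  (forall (u : R -> 'cV[R]_1) (x : R -> 'cV[R]_n) (xb : R -> 'cV[R]_nb),
    L2e u ->
    state_trajectory A B 0 u x ->
    state_trajectory Ab Bb 0 u xb ->
    forall t : R, 0 <= t ->
      Cb2 *m xb t = C2 *m x t /\
      forall j : 'I_p1,
        (Cb1 *m xb t) j 0
        = modified_output r2min (r1 j) (fun s => (C1 *m x s) j 0) t) ->
  (forall j, is_relative_degree Ab Bb (row j Cb1) (rb1 j)) ->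
  (forall j, is_relative_degree Ab Bb (row j Cb2) (rb2 j)) ->
  is_least (range rb1) rb1min ->
  is_least (range rb2) rb2min ->
  (rb1min >= rb2min)%N.
Proof.
move=> _ _ _ dC1 dC2 [[j2 _ r2j2] _] out dCb1 dCb2 [[j1 _ <-] _] [_ le_rb2].
have {}out := out _ _ _ (@L2e_cst _ _ _) (@state_trajectory_step_state _ _ A B)
  (@state_trajectory_step_state _ _ Ab Bb).
have bA := @geometrically_bounded_mul_step_coef _ _ A B.
have bAb := @geometrically_bounded_mul_step_coef _ _ Ab Bb.
have rowE m q (D : 'M[R]_(q, m)) (v : 'cV[R]_m) j :
  (row j D *m v) 0 0 = (D *m v) j 0 by rewrite -row_mul mxE.
have rb2min_le : (rb2min <= r2min)%N.
  suff rb2j2 : rb2 j2 = r2min by rewrite -rb2j2; apply: le_rb2; exists j2.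
  rewrite -r2j2; apply: is_least_unique (dCb2 j2) _.
  apply/is_relative_degree_step_coef.
  move/is_relative_degree_step_coef : (dC2 j2).
  (* Equal step responses force equal Markov parameters, hence equal relative degrees. *)
  have coefE : (fun k => (C2 *m step_coef A B k) j2 0) =
      (fun k => (Cb2 *m step_coef Ab Bb k) j2 0).
    apply: egf_inj => // t t0.
    by rewrite -!mul_step_stateE; case: (out t t0) => ->.
  congr (is_least _ _); apply/funext => k /=; rewrite !rowE.
  by have /= -> := congr1 (@^~ k) coefE.
(* Otherwise the coefficient at [rb1 j1], nonzero by definition, would lie below [r2min] and
   vanish. *)
apply: leq_trans rb2min_le _; rewrite leqNgt; apply/negP => rb1_lt.
pose a k := (C1 *m step_coef A B k) j1 0.
have a0 k : (k < r1 j1)%N -> a k = 0.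
  move=> kr1; apply/eqP; apply: contraTT kr1 => /eqP ak0; rewrite -leqNgt.
  have /is_relative_degree_step_coef[_] := dC1 j1; apply.
  by rewrite /= rowE.
have /is_relative_degree_step_coef[] := dCb1 j1; rewrite /= rowE => + _; apply.
(* Truncated subtraction gives [m = 0] when [r2min <= r1 j1], so [m] integrations describe both
   branches of [modified_output]. *)
pose m := (r2min - r1 j1)%N.
have [bm fm] := iter_integral_from0_egf m (bA _ C1 j1)
  (fun t _ => mul_step_stateE A B C1 j1 t).
have coefE : (fun k => (Cb1 *m step_coef Ab Bb k) j1 0) =
    iter m (@cons0_seq R) a.
  apply: egf_inj => // t t0.
  rewrite -mul_step_stateE -fm//; case: (out t t0) => _ ->.
  rewrite /modified_output; case: ifP => // /eqP m0.
  by rewrite /m m0.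
have /= -> := congr1 (@^~ (rb1 j1)) coefE.
apply: (iter_cons0_seq_eq0 a0).
(* Here [m + r1 j1] is the maximum of [r1 j1] and [r2min]. *)
by rewrite (leq_trans rb1_lt)// /m addnC -maxnE leq_maxr.
Qed.
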